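(* Let $\mathcal{S}$ be an addable abstract numeration system. Let $\mathbf{x}$ be an $\mathcal{S}$-automatic infinite word over a finite alphabet $A$ with sublinear factor complexity, i.e. $\rho_{\mathbf{x}}(n)=\mathcal{O}(n)$, and let $X$ be the subshift generated by $\mathbf{x}$ (its orbit closure). Then the winning shift $W(X)\subseteq\mathbb{N}^{\mathbb{N}}$ is $\mathcal{S}$-codable.
   Context: Subshifts are one-sided: a subshift is a closed (product topology) shift-invariant subset of $A^{\mathbb{N}}$; the subshift generated by $\mathbf{x}$ is the closure of $\{$shifts of $\mathbf{x}\}$. $\rho_{\mathbf{x}}(n)$ is the number of distinct factors of length $n$ of $\mathbf{x}$. Winning shift: for $X\subseteq A^{\mathbb{N}}$ and a choice sequence $\alpha=\alpha_0\alpha_1\cdots\in\{0,\dots,|A|-1\}^{\mathbb{N}}$, Alice and Bob play infinitely many rounds; in round $j$ Alice chooses $A_j\subseteq A$ with $|A_j|=\alpha_j+1$ and Bob chooses $a_j\in A_j$; Alice wins if $a_0a_1\cdots\in X$. $W(X)$ is the set of $\alpha$ for which Alice has a winning strategy (for subshifts $X$ it is a subshift of $\{0,\dots,|A|-1\}^{\mathbb{N}}\subseteq\mathbb{N}^{\mathbb{N}}$). Abstract numeration system (ANS): $\mathcal{S}=(L,\prec)$ with $L$ an infinite language over a finite alphabet and $\prec$ a total order on $L$ of order type $\omega$; $\mathrm{rep}(n)$ is the $n$-th word of $L$ (starting from $n=0$) and $\mathrm{val}=\mathrm{rep}^{-1}$. For $(n_1,\dots,n_d)\in\mathbb{N}^d$,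 $\mathrm{rep}(n_1,\dots,n_d)$ is the word over $(\Sigma\cup\{\#\})^d$ obtained by left-padding the words $\mathrm{rep}(n_i)$ with a new symbol $\#$ to a common length. $Y\subseteq\mathbb{N}^d$ is $\mathcal{S}$-recognizable if $\mathrm{rep}(Y)$ is a regular language. $\mathcal{S}$ is addable if $\{(x,y,x+y):x,y\in\mathbb{N}\}$ is $\mathcal{S}$-recognizable. An infinite word $\mathbf{x}$ is $\mathcal{S}$-automatic if there is a deterministic finite automaton with output whose output on input $\mathrm{rep}(n)$ is $\mathbf{x}[n]$ for all $n\ge0$. Codability: for $\mathbf{y}=y_0y_1\cdots\in\mathbb{N}^{\mathbb{N}}$ put $\sum\mathbf{y}=\sum_i y_i$. If $\sum\mathbf{y}=d<\infty$, $\nu(\mathbf{y})$ is the unique $(n_1,\dots,n_d)\in\mathbb{N}^d$ with $n_1\le\dots\le n_d$ and $y_j=|\{k:n_k=j\}|$ for all $j$. The coding dimension of $Y\subseteq\mathbb{N}^{\mathbb{N}}$ is the least $d$ with $\sum\mathbf{y}\le d$ for all $\mathbf{y}\in Y$, if it exists (otherwise $Y$ has infinite coding dimension). $Y$ is weakly $\mathcal{S}$-codable if for every $k\in\mathbb{N}$ the set $\{\nu(\mathbf{y}):\mathbf{y}\in Y,\sum\mathbf{y}\le k\}\subseteq\mathbb{N}^{\le k}$ is $\mathcal{S}$-recognizable (a subset of $\mathbb{N}\cup\dots\cup\mathbb{N}^k$ is $\mathcal{S}$-recognizable if its intersection with each $\mathbb{N}^i$ is); $Y$ is $\mathcal{S}$-codable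 if it is weakly $\mathcal{S}$-codable and has finite coding dimension. *)

(* Defs.v *)
From mathcomp Require Import all_boot.
From mathcomp Require Import boolp.
Set Implicit Arguments. Unset Strict Implicit. Unset Printing Implicit Defensive.

Definition regular (B : finType) (L : seq B -> Prop) : Prop :=
  exists (n : nat) (q0 : 'I_n.+1) (delta : 'I_n.+1 -> B -> 'I_n.+1)
         (F : {set 'I_n.+1}),
    forall w : seq B, L w <-> foldl delta q0 w \in F.

(* An ANS (L, <) with L infinite over Sigma and < of order type omega is
   given by its enumeration rep : nat -> seq Sigma (rep n = n-th word of L),
   which must be injective; L is the range of rep. *)

(* rep(n_1,...,n_d): left-pad each rep(n_i) with # (= None) to common length. *)
Definition rep_tuple (Sigma : finType) (rep : nat -> seq Sigma) (d : nat)
    (t : d.-tuple nat) : seq (d.-tuple (option Sigma)) :=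
  let m := \max_(i < d) size (rep (tnth t i)) in
  [seq mktuple (fun i : 'I_d =>
        let w := rep (tnth t i) in
        if p < m - size w then None else onth w (p - (m - size w)))
   | p <- iota 0 m].

Definition recognizable (Sigma : finType) (rep : nat -> seq Sigma) (d : nat)
    (Y : d.-tuple nat -> Prop) : Prop :=
  regular (fun w => exists t, Y t /\ w = rep_tuple rep t).

Definition addable (Sigma : finType) (rep : nat -> seq Sigma) : Prop :=
  recognizable rep (fun t : 3.-tuple nat => nth 0 t 2 = nth 0 t 0 + nth 0 t 1).

Definition automatic (Sigma : finType) (rep : nat -> seq Sigma)
    (A : finType) (x : nat -> A) : Prop :=
  exists (n : nat) (q0 : 'I_n.+1) (delta : 'I_n.+1 -> Sigma -> 'I_n.+1)
         (tau : 'I_n.+1 -> A),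
    forall m, tau (foldl delta q0 (rep m)) = x m.

Definition factor_at (A : Type) (x : nat -> A) (i n : nat) : seq A :=
  [seq x (i + k) | k <- iota 0 n].

Definition rho (A : finType) (x : nat -> A) (n : nat) : nat :=
  #|[set w : n.-tuple A | `[< exists i, val w = factor_at x i n >]]|.

(* Subshift generated by x: closure of the shift-orbit of x in the product
   topology of A^N (basic open sets = cylinders fixing a prefix). *)
Definition orbit_closure (A : Type) (x : nat -> A) : (nat -> A) -> Prop :=
  fun y => forall n, exists k, forall i, i < n -> y i = x (k + i).

(* Winning shift: alpha in W(X) iff Alice has a winning strategy.
   A strategy for Alice maps the history a_0...a_{j-1} of Bob's choices to the
   set A_j, of size alpha_j + 1; Alice wins if every play consistent with it
   lies in X. *)
Definition winning_shift (A : finType) (X : (nat -> A) -> Prop)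
    : (nat -> nat) -> Prop :=
  fun alpha =>
    (forall j, alpha j < #|A|) /\
    exists sigma : seq A -> {set A},
      (forall h, #|sigma h| = (alpha (size h)).+1) /\
      (forall a : nat -> A,
         (forall j, a j \in sigma [seq a k | k <- iota 0 j]) -> X a).

Definition sum_le (y : nat -> nat) (d : nat) : Prop :=
  exists N, (forall i, N <= i -> y i = 0) /\ \sum_(i < N) y i <= d.

Definition nu_of (y : nat -> nat) (t : seq nat) : Prop :=
  sorted leq t /\ forall j, count_mem j t = y j.

Definition finite_coding_dim (Y : (nat -> nat) -> Prop) : Prop :=
  exists d, forall y, Y y -> sum_le y d.

(* for each k, {nu(y) : y in Y, sum y <= k} (subset of N^1 u ... u N^k)
   is S-recognizable, i.e. its intersection with each N^i is. *)
Definition weakly_codable (Sigma : finType) (rep : nat -> seq Sigma)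
    (Y : (nat -> nat) -> Prop) : Prop :=
  forall k i, 1 <= i <= k ->
    recognizable rep
      (fun t : i.-tuple nat => exists y, Y y /\ sum_le y k /\ nu_of y t).

Definition codable (Sigma : finType) (rep : nat -> seq Sigma)
    (Y : (nat -> nat) -> Prop) : Prop :=
  weakly_codable rep Y /\ finite_coding_dim Y.

(* Main.v *)
Require Import Defs.
From mathcomp Require Import all_boot.
From mathcomp Require Import boolp zify.
Set Implicit Arguments. Unset Strict Implicit. Unset Printing Implicit Defensive.

(** Weak codability is a definability argument: relations recognizable in an
addable numeration system are closed under Boolean operations and
quantification over natural numbers, and that Alice wins for a choice sequence
with finitely many nonzero entries is a first-order property of their positions,
since each factor [x[i..i+n)] extends to the point [x[i..]] of the subshift, so
that only the finitely many rounds offering a choice need quantifiers.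

Finiteness of the coding dimension rests on Cassaigne's theorem that the number
of right special factors of each length is bounded when the complexity is linear.
If [alpha n > 0], all [\prod_(j < n) (alpha j + 1)] plays of length [n] that are
consistent with a winning strategy are right special, so [\sum_j alpha j] is
bounded. *)

(** * Regular languages *)

(** Any finite type of states is allowed, so that product and subset automata need no
    renumbering. *)
Definition reg (B : finType) (L : seq B -> Prop) : Prop :=
  exists (Q : finType) (q0 : Q) (delta : Q -> B -> Q) (F : pred Q),
    forall w, L w <-> F (foldl delta q0 w).

Fixpoint strip (B : eqType) (b : B) (w : seq B) : seq B :=
  if w is a :: w' then if a == b then strip b w' else w else [::].

Lemma strip_nseq (B : eqType) (b : B) k w :
  strip b (nseq k b ++ w) = strip b w.
Proof. by elim: k => //= k ->; rewrite eqxx. Qed.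

Lemma strip_notin (B : eqType) (b : B) w : b \notin w -> strip b w = w.
Proof.
by case: w => //= a w; rewrite inE negb_or eq_sym => /andP[/negbTE-> _].
Qed.

Lemma stripP (B : eqType) (b : B) w : exists k, w = nseq k b ++ strip b w.
Proof.
elim: w => [|a w [k IH]] /=; first by exists 0.
case: eqP => [->|_]; last by exists 0.
by exists k.+1; rewrite /= -IH.
Qed.

Section Regular.
Variable B : finType.
Implicit Types L : seq B -> Prop.

Lemma reg_ext L L' : (forall w, L w <-> L' w) -> reg L -> reg L'.
Proof.
by move=> LL' [Q [q0 [d [F H]]]]; exists Q, q0, d, F => w; rewrite -LL'.
Qed.

Lemma regular_reg L : regular L -> reg L.
Proof. by move=> [n [q0 [d [F H]]]]; exists 'I_n.+1, q0, d, (mem F). Qed.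

Lemma reg_regular L : reg L -> regular L.
Proof.
move=> [Q [q0 [d [F H]]]].
have [n cardQ] : exists n, #|Q| = n.+1.
  by exists #|Q|.-1; rewrite prednK //; apply/card_gt0P; exists q0.
pose to (q : Q) : 'I_n.+1 := cast_ord cardQ (enum_rank q).
pose of_ (i : 'I_n.+1) : Q := enum_val (cast_ord (esym cardQ) i).
have toK q : of_ (to q) = q by rewrite /of_ /to cast_ordK enum_rankK.
exists n, (to q0), (fun i a => to (d (of_ i) a)), [set i | F (of_ i)] => w.
rewrite inE H.
suff -> : foldl (fun i a => to (d (of_ i) a)) (to q0) w = to (foldl d q0 w).
  by rewrite toK.
by elim/last_ind: w => // w a IH; rewrite !foldl_rcons IH toK.
Qed.

Lemma reg_const (P : Prop) : @reg B (fun=> P).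
Proof.
exists unit, tt, (fun _ _ => tt), (fun=> `[< P >]) => w.
by split=> [/asboolP|/asboolP].
Qed.

Lemma reg_not L : reg L -> reg (fun w => ~ L w).
Proof.
move=> [Q [q0 [d [F H]]]]; exists Q, q0, d, (predC F) => w /=.
by rewrite H; split=> /negP.
Qed.

Lemma reg_and L L' : reg L -> reg L' -> reg (fun w => L w /\ L' w).
Proof.
move=> [Q [q0 [d [F H]]]] [Q' [q0' [d' [F' H']]]].
exists (Q * Q')%type, (q0, q0'), (fun q a => (d q.1 a, d' q.2 a)),
  (fun q => F q.1 && F' q.2) => w.
rewrite H H'.
suff -> : foldl (fun q a => (d q.1 a, d' q.2 a)) (q0, q0') w =
          (foldl d q0 w, foldl d' q0' w) by split=> /andP.
by elim/last_ind: w => // w a IH; rewrite !foldl_rcons IH.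
Qed.

Lemma reg_forall (I : finType) (L : I -> seq B -> Prop) :
  (forall i, reg (L i)) -> reg (fun w => forall i, L i w).
Proof.
move=> regL.
have: reg (fun w => forall i, i \in enum I -> L i w).
  elim: (enum I) => [|i s IH].
    by apply: reg_ext (reg_const True) => w; split=> // _ i; rewrite in_nil.
  apply: reg_ext (reg_and (regL i) IH) => w; split=> [[Li Ls] j|H].
    by rewrite inE => /predU1P[->|/Ls].
  by split=> [|j js]; apply: H; rewrite inE ?eqxx ?js ?orbT.
by apply: reg_ext => w; split=> H i *; apply: H; rewrite ?mem_enum.
Qed.

(** Subset construction, started from all states reachable by reading a block of [b]. *)
Lemma reg_lquot (b : B) L :
  reg L -> reg (fun w => exists k, L (nseq k b ++ w)).
Proof.
move=> [Q [q0 [d [F H]]]].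
pose S0 := [set q | `[< exists k, q = foldl d q0 (nseq k b) >]].
exists {set Q}, S0, (fun S a => [set d q a | q in S : {set Q}]),
  (fun S : {set Q} => [exists q in S, F q]) => w.
have inS q : reflect (exists k, q = foldl d q0 (nseq k b ++ w))
    (q \in foldl (fun S a => [set d q a | q in S : {set Q}]) S0 w).
  apply: (iffP idP); elim/last_ind: w q => [|w a IH] q.
  - by rewrite inE => /asboolP[k ->]; exists k; rewrite cats0.
  - rewrite foldl_rcons => /imsetP[q' /IH[k ->] ->].
    by exists k; rewrite -rcons_cat foldl_rcons.
  - by move=> [k ->]; rewrite inE; apply/asboolP; exists k; rewrite cats0.
  - move=> [k ->]; rewrite -rcons_cat !foldl_rcons; apply: imset_f.
    by apply: IH; exists k.
split=> [[k /H Fk]|/existsP[q /andP[/inS[k ->] Fk]]].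
  by apply/existsP; eexists; apply/andP; split; [apply/inS; exists k|].
by exists k; apply/H.
Qed.

(** The flag in the state records that a letter other than [b] has been read; until then the
    automaton waits in [q0]. *)
Lemma reg_strip (b : B) L : reg L -> reg (fun w => L (strip b w)).
Proof.
move=> [Q [q0 [d [F H]]]].
pose D (q : Q * bool) a :=
  if q.2 || (a != b) then (d q.1 a, true) else q.
exists (Q * bool)%type, (q0, false), D, (fun q => F q.1) => w.
rewrite H; suff -> : (foldl D (q0, false) w).1 = foldl d q0 (strip b w) by [].
have started u q : foldl D (q, true) u = (foldl d q u, true).
  by elim: u q => //= a u IH q; rewrite IH.
elim: w => //= a w IH; rewrite {2}/D /=.
by case: eqP => //= _; rewrite started.
Qed.

Lemma reg_ohead (P : option B -> Prop) : reg (fun w => P (ohead w)).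
Proof.
exists (option B), None, (fun q a => if q is Some _ then q else Some a),
  (fun q => `[< P q >]) => w.
suff -> : foldl (fun q a => if q is Some _ then q else Some a) None w = ohead w.
  by split=> /asboolP.
by case: w => //= a; elim.
Qed.

Lemma reg_notin (b : B) : reg (fun w : seq B => b \notin w).
Proof.
exists bool, true, (fun q a => q && (a != b)), id => w.
suff -> : foldl (fun q a => q && (a != b)) true w = (b \notin w) by [].
elim/last_ind: w => // w a IH.
by rewrite foldl_rcons IH mem_rcons inE negb_or andbC eq_sym.
Qed.

End Regular.

Lemma reg_preim (B C : finType) (g : B -> C) (L : seq C -> Prop) :
  reg L -> reg (fun w => L (map g w)).
Proof.
move=> [Q [q0 [d [F H]]]]; exists Q, q0, (fun q a => d q (g a)), F => w.
rewrite H; suff -> : foldl d q0 (map g w) = foldl (fun q a => d q (g a)) q0 w.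
  by [].
by elim/last_ind: w => // w a IH; rewrite map_rcons !foldl_rcons IH.
Qed.

(** Subset construction for the automaton that guesses a preimage of each letter; existential
    quantifiers are projections of this kind. *)
Lemma reg_im (B C : finType) (g : B -> C) (L : seq B -> Prop) :
  reg L -> reg (fun w => exists w', map g w' = w /\ L w').
Proof.
move=> [Q [q0 [d [F H]]]].
pose D (S : {set Q}) c :=
  [set d p.1 p.2 | p in [set p : Q * B | (p.1 \in S) && (g p.2 == c)]].
exists {set Q}, [set q0], D, (fun S : {set Q} => [exists q in S, F q]) => w.
have inS q : reflect (exists w', map g w' = w /\ q = foldl d q0 w')
    (q \in foldl D [set q0] w).
  apply: (iffP idP); elim/last_ind: w q => [|w a IH] q.
  - by rewrite inE => /eqP->; exists [::].
  - rewrite foldl_rcons => /imsetP[[q' b]]; rewrite inE /=.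
    move=> /andP[/IH[w' [<- ->]] /eqP<-] ->.
    by exists (rcons w' b); rewrite map_rcons foldl_rcons.
  - by move=> [w' [/eqP]]; case: w' => //= _ ->; rewrite inE.
  - move=> [w']; case/lastP: w' => [|w' b]; first by case; case: w {IH}.
    rewrite map_rcons => -[/rcons_inj[E <-] ->]; rewrite !foldl_rcons.
    apply/imsetP; exists (foldl d q0 w', b) => //.
    by rewrite inE eqxx andbT IH //; exists w'.
split=> [[w' [gw' /H Fw]]|/existsP[q /andP[/inS[w' [<- ->]] Fq]]].
  by apply/existsP; eexists; apply/andP; split; [apply/inS; exists w'|].
by exists w'; split=> //; apply/H.
Qed.

(** * Recognizable relations *)

Section Convolution.
Variables (Sigma : finType) (rep : nat -> seq Sigma).

(** Tracks are indexed by any finite type of variables, so that a quantifier enlarges it by a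
    disjoint sum. *)
Definition letter (V : finType) := {ffun V -> option Sigma}.

Definition blank (V : finType) : letter V := [ffun=> None].

Definition pad m (w : seq Sigma) : seq (option Sigma) :=
  nseq (m - size w) None ++ map Some w.

Definition conv (V : finType) m (e : V -> nat) : seq (letter V) :=
  mkseq (fun p => [ffun v => nth None (pad m (rep (e v))) p]) m.

Definition track (V : finType) (v : V) (w : seq (letter V)) :=
  [seq a v | a : letter V <- w].

Definition fits (V : finType) m (e : V -> nat) :=
  forall v, size (rep (e v)) <= m.

Definition valid_track (u : seq (option Sigma)) :=
  exists n k, u = nseq k None ++ map Some (rep n).

Lemma size_pad m w : size w <= m -> size (pad m w) = m.
Proof. by move=> wm; rewrite size_cat size_nseq size_map subnK. Qed.

Lemma None_notin_mapSome (w : seq Sigma) : None \notin map Some w.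
Proof. by apply/mapP=> -[]. Qed.

Lemma strip_pad k w : strip (None : option Sigma) (nseq k None ++ map Some w) = map Some w.
Proof. by rewrite strip_nseq strip_notin ?None_notin_mapSome. Qed.

Lemma track_conv (V : finType) m (e : V -> nat) v :
  size (rep (e v)) <= m -> track v (conv m e) = pad m (rep (e v)).
Proof.
move=> em; rewrite /track -map_comp.
rewrite -[RHS](mkseq_nth None) size_pad //.
by apply: eq_map => p /=; rewrite ffunE.
Qed.

Lemma eq_tracks (V : finType) (w w' : seq (letter V)) :
  size w = size w' -> (forall v, track v w = track v w') -> w = w'.
Proof.
move=> sz tr; apply: (@eq_from_nth _ (blank V)) => // p pw.
apply/ffunP=> v; have := congr1 (nth None ^~ p) (tr v).
by rewrite /track !(nth_map (blank V)) -?sz.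
Qed.

Lemma conv_blank (V : finType) k m (e : V -> nat) :
  fits m e -> nseq k (blank V) ++ conv m e = conv (k + m) e.
Proof.
move=> em; apply: eq_tracks => [|v].
  by rewrite size_cat size_nseq !size_mkseq.
rewrite track_conv; last by apply: leq_trans (em v) _; rewrite leq_addl.
rewrite /track map_cat -/(track v (conv m e)) track_conv // /pad catA map_nseq ffunE.
by rewrite -nseqD addnBA.
Qed.

Lemma conv_reindex (U V : finType) (f : V -> U) m (e : U -> nat) :
  [seq [ffun v => a (f v)] | a : letter U <- conv m e] = conv m (e \o f).
Proof.
rewrite -map_comp; apply: eq_map => p /=.
by apply/ffunP=> v; rewrite !ffunE.
Qed.

(** All tracks of a word have the same length, which determines the padding of each one. *)
Lemma conv_of_tracks (V : finType) (w : seq (letter V)) (e : V -> nat) :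
  (forall v, exists k, track v w = nseq k None ++ map Some (rep (e v))) ->
  fits (size w) e /\ w = conv (size w) e.
Proof.
move=> He; have em : fits (size w) e.
  move=> v; have [k /(congr1 size)] := He v.
  by rewrite size_map size_cat size_nseq size_map => ->; rewrite leq_addl.
split=> //; apply: eq_tracks => [|v]; first by rewrite size_mkseq.
rewrite track_conv // /pad; have [k tr] := He v; rewrite tr.
have := congr1 size tr; rewrite size_map size_cat size_nseq size_map.
by move=> ->; rewrite addnK.
Qed.

Definition tuple_letter d (a : letter 'I_d) : d.-tuple (option Sigma) :=
  [tuple a i | i < d].

Definition letter_tuple d (a : d.-tuple (option Sigma)) : letter 'I_d :=
  [ffun i => tnth a i].

Lemma letter_tupleK d : cancel (@letter_tuple d) (@tuple_letter d).
Proof. by move=> a; apply: eq_from_tnth => i; rewrite tnth_mktuple ffunE. Qed.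

Lemma rep_tuple_conv d (t : d.-tuple nat) :
  rep_tuple rep t =
    [seq tuple_letter a | a <- conv (\max_(i < d) size (rep (tnth t i))) (tnth t)].
Proof.
rewrite /rep_tuple -map_comp; apply: eq_map => p /=.
apply: eq_from_tnth => i; rewrite !tnth_mktuple ffunE /pad nth_cat size_nseq.
by case: ifP => lt; rewrite ?nth_nseq ?lt // onthE.
Qed.

Lemma fits_max d (e : 'I_d -> nat) : fits (\max_(i < d) size (rep (e i))) e.
Proof. by move=> v; apply: (@leq_bigmax _ (fun i => size (rep (e i)))). Qed.

(** The longest component gets no padding, so its track starts with a genuine symbol. Hence
    [rep_tuple rep t] is the stripped form of every convolution of [t]. *)
Lemma ohead_rep_tuple d (t : d.-tuple nat) :
  ohead (rep_tuple rep t) <> Some (tuple_letter (blank 'I_d)).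
Proof.
rewrite rep_tuple_conv; set M := \max_(i < d) _.
case: (posnP M) => [->|M0] //.
have d0 : 0 < #|'I_d|.
  by rewrite card_ord lt0n; apply: contraTneq M0 => d0; subst d; rewrite /M big_ord0.
have [i Ei] := @eq_bigmax _ (fun i => size (rep (tnth t i))) d0.
have := track_conv (@fits_max _ (tnth t) i); rewrite -/M.
case: (conv M (tnth t)) (size_mkseq _ M : size (conv M (tnth t)) = M) => [|a w] /=.
  by move=> E0; rewrite -E0 in M0.
move=> _; rewrite /pad /M Ei subnn /= => E /Some_inj.
move=> /(congr1 (fun b => tnth b i)); rewrite !tnth_mktuple ffunE => ai.
have := None_notin_mapSome (rep (tnth t i)).
by rewrite -E inE ai eqxx.
Qed.

Lemma strip_ohead (B : eqType) (b : B) w : ohead w <> Some b -> strip b w = w.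
Proof. by case: w => //= a w; case: eqP => // ->. Qed.

Lemma strip_conv d (e : 'I_d -> nat) m : fits m e ->
  strip (tuple_letter (blank 'I_d)) [seq tuple_letter a | a <- conv m e] =
  rep_tuple rep (mktuple e).
Proof.
move=> em; set t := mktuple e.
have te : tnth t = e by apply/funext=> i; rewrite tnth_mktuple.
have Mm : \max_(i < d) size (rep (e i)) <= m by apply/bigmax_leqP=> i _; apply: em.
rewrite -(subnK Mm) -conv_blank; last exact: fits_max.
rewrite map_cat map_nseq strip_nseq -te -rep_tuple_conv.
exact/strip_ohead/ohead_rep_tuple.
Qed.

Lemma rep_tuple_inj d : injective rep -> injective (@rep_tuple _ rep d).
Proof.
move=> inj_rep t t' E; apply: eq_from_tnth => i; apply: inj_rep.
have tr (u : d.-tuple nat) : strip None [seq tnth a i | a <- rep_tuple rep u] =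
    map Some (rep (tnth u i)).
  rewrite rep_tuple_conv -map_comp.
  rewrite (eq_map (_ : _ =1 fun a : letter 'I_d => a i)); last first.
    by move=> a /=; rewrite tnth_mktuple.
  by rewrite -/(track i _) track_conv ?strip_pad //; apply: fits_max.
by apply: (inj_map Some_inj); rewrite -!tr E.
Qed.

(** The graph of addition projects onto all of [nat], so its first track yields every
    representation. Longer companions cause surplus padding there, which the left quotient
    removes. *)
Lemma reg_valid_track : addable rep -> reg valid_track.
Proof.
move=> /regular_reg/(@reg_im _ _ (fun a => tnth a ord0))/(reg_lquot None) regL.
have := reg_strip None (reg_and regL (reg_notin None)); apply: reg_ext => u.
have tr (t : 3.-tuple nat) : exists k,
    [seq tnth a ord0 | a <- rep_tuple rep t] =
    nseq k None ++ map Some (rep (tnth t ord0)).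
  rewrite rep_tuple_conv -map_comp.
  rewrite (eq_map (_ : _ =1 fun a : letter 'I_3 => a ord0)); last first.
    by move=> a /=; rewrite tnth_mktuple.
  by eexists; rewrite -/(track ord0 _) track_conv //; apply: fits_max.
split=> [[[k [w [Ew [t [_ Et]]]]] notN]|[n [k ->]]].
  have [k' E'] := tr t; move: Ew; rewrite Et E' => /(congr1 (strip None)).
  rewrite strip_pad strip_nseq (strip_notin notN) => E.
  by have [k'' ->] := stripP None u; exists (tnth t ord0), k''; rewrite E.
rewrite strip_pad; split; last exact: None_notin_mapSome.
(* The triple (n, 0, n) lies in the graph of addition and carries [n] on its first track. *)
have [k' E] := tr [tuple n; 0; n]; exists k', (rep_tuple rep [tuple n; 0; n]).
by split=> //; exists [tuple n; 0; n]; rewrite /= addn0.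
Qed.

(* Every amount of left padding must give the right answer, but words that are
   not convolutions are unconstrained; this makes Boolean closure immediate. *)
Definition rec (V : finType) (R : (V -> nat) -> Prop) : Prop :=
  exists2 L, reg L & forall e m, fits m e -> (R e <-> L (conv m e)).

(** * Boolean closure of recognizable relations *)

Section Closure.
Variable V : finType.
Implicit Types R : (V -> nat) -> Prop.

Lemma rec_ext R R' : (forall e, R e <-> R' e) -> rec R -> rec R'.
Proof.
by move=> RR' [L regL H]; exists L => // e m em; rewrite -RR'; apply: H.
Qed.

Lemma rec_const (P : Prop) : @rec V (fun=> P).
Proof. by exists (fun=> P) => //; apply: reg_const. Qed.

Lemma rec_not R : rec R -> rec (fun e => ~ R e).
Proof.
move=> [L regL H]; exists (fun w => ~ L w); first exact: reg_not.
by move=> e m em; rewrite (H e m em).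
Qed.

Lemma rec_and R R' : rec R -> rec R' -> rec (fun e => R e /\ R' e).
Proof.
move=> [L regL H] [L' regL' H']; exists (fun w => L w /\ L' w); first exact: reg_and.
by move=> e m em; rewrite (H e m em) (H' e m em).
Qed.

Lemma rec_imply R R' : rec R -> rec R' -> rec (fun e => R e -> R' e).
Proof.
move=> recR /rec_not/(rec_and recR)/rec_not; apply: rec_ext => e; split.
  by move=> H Re; apply: contrapT => nR'; apply: H.
by move=> RR' [/RR'].
Qed.

Lemma rec_iff R R' : rec R -> rec R' -> rec (fun e => R e <-> R' e).
Proof. by move=> *; apply: rec_and; apply: rec_imply. Qed.

Lemma rec_forall (I : finType) (R : I -> (V -> nat) -> Prop) :
  (forall i, rec (R i)) -> rec (fun e => forall i, R i e).
Proof.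
move=> recR; have /choice[L HL] : forall i, exists L,
    reg L /\ forall e m, fits m e -> (R i e <-> L (conv m e)).
  by move=> i; have [L ? ?] := recR i; exists L.
exists (fun w => forall i, L i w); first by apply: reg_forall => i; case: (HL i).
by move=> e m em; split=> H i; apply/((HL i).2 e m em); apply: H.
Qed.

Lemma rec_exists_fin (I : finType) (R : I -> (V -> nat) -> Prop) :
  (forall i, rec (R i)) -> rec (fun e => exists i, R i e).
Proof.
move=> recR; have := rec_not (rec_forall (fun i => rec_not (recR i))).
apply: rec_ext => e; split=> [nR|[i Ri] /(_ i)] //.
by apply: contrapT => nE; apply: nR => i Ri; apply: nE; exists i.
Qed.

(** Only finitely many sets can occur, and that a given one does is a finite conjunction. This makes
    multiplicities definable without counting. *)
Lemma rec_set_of (I : finType) (R : I -> (V -> nat) -> Prop) (P : {set I} -> Prop) :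
  (forall i, rec (R i)) -> rec (fun e => P [set i | `[< R i e >]]).
Proof.
move=> recR.
have : rec (fun e => exists E, P E /\ forall i, R i e <-> i \in E).
  apply: rec_exists_fin => E; apply: rec_and; first exact: rec_const.
  by apply: rec_forall => i; apply: rec_iff => //; apply: rec_const.
apply: rec_ext => e; split=> [[E [PE HE]]|PE].
  suff -> : [set i | `[< R i e >]] = E by [].
  by apply/setP=> i; rewrite inE; apply/asboolP/idP => /HE.
by eexists; split; [exact: PE|] => i; rewrite inE; split=> /asboolP.
Qed.

End Closure.

(** * Substitution and quantification *)

Lemma rec_reindex (U V : finType) (f : V -> U) (R : (V -> nat) -> Prop) :
  rec R -> rec (fun e : U -> nat => R (e \o f)).
Proof.
move=> [L regL H]; exists (fun w => L [seq [ffun v => a (f v)] | a : letter U <- w]).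
  exact: reg_preim.
by move=> e m em; rewrite conv_reindex -H // => v; apply: em.
Qed.

Definition sum_env (V S : Type) (e : V -> nat) (p : S -> nat) (u : V + S) : nat :=
  match u with inl v => e v | inr s => p s end.

(** A witness may have a longer representation than the padding [m] leaves room for, so the
    automaton first guesses [k] more blank letters on the left and then the new tracks.
    [valid_track] forces the guessed tracks to represent numbers. *)
Lemma rec_exists (V S : finType) (R : (V + S -> nat) -> Prop) :
  addable rep -> rec R -> rec (fun e => exists p, R (sum_env e p)).
Proof.
move=> add [L regL H].
pose prV (a : letter (V + S)%type) : letter V := [ffun v => a (inl v)].
exists (fun w => exists k w', map prV w' = nseq k (blank V) ++ w /\
    (L w' /\ forall s, valid_track (track (inr s) w'))).
  apply: (@reg_lquot _ (blank V)
    (fun w => exists w', map prV w' = w /\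
       (L w' /\ forall s, valid_track (track (inr s) w')))).
  apply: reg_im; apply: reg_and => //; apply: reg_forall => s.
  exact: reg_preim (reg_valid_track add).
have prV_conv M e : map prV (conv M e) = conv M (e \o inl) by apply: conv_reindex.
move=> e m em; split=> [[p Rp]|[k [w' [Ew [Lw vw]]]]].
  pose M := m + \max_(s : S) size (rep (p s)).
  have eM : fits M (sum_env e p).
    case=> [v|s] /=; first by apply: leq_trans (em v) (leq_addr _ _).
    by apply: leq_trans (leq_addl _ _); apply: (@leq_bigmax _ (fun s => size (rep (p s)))).
  exists (M - m), (conv M (sum_env e p)); split; last split.
  - by rewrite conv_blank // subnK ?leq_addr // prV_conv.
  - exact/H.
  - by move=> s; rewrite track_conv //; exists (p s), (M - size (rep (p s))).
move: Ew; rewrite conv_blank // => Ew.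
have tV v : track (inl v) w' = track v (conv (k + m) e).
  by rewrite -Ew /track -map_comp; apply: eq_map => a; rewrite /= ffunE.
have [p Hp] := choice vw; exists p.
have [em' E'] : fits (size w') (sum_env e p) /\ w' = conv (size w') (sum_env e p).
  apply: conv_of_tracks => -[v|s] /=; last exact: Hp.
  rewrite tV track_conv ?(leq_trans (em v)) ?leq_addl //.
  by exists (k + m - size (rep (e v))).
by apply/(H _ _ em'); rewrite -E'.
Qed.

Lemma rec_exists1 (V : finType) (R : (V + unit -> nat) -> Prop) :
  addable rep -> rec R -> rec (fun e => exists p : nat, R (sum_env e (fun=> p))).
Proof.
move=> add /(rec_exists add); apply: rec_ext => e; split=> [[p Rp]|[p Rp]].
  by exists (p tt); rewrite (_ : (fun=> p tt) = p) //; apply/funext=> -[].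
by exists (fun=> p).
Qed.

(** The language given by [rec] is arbitrary outside convolutions. Requiring valid tracks and a
    first letter that is not blank leaves exactly the words [rep_tuple rep t]. *)
Lemma rec_recognizable d (R : ('I_d -> nat) -> Prop) :
  addable rep -> rec R -> recognizable rep (fun t : d.-tuple nat => R (tnth t)).
Proof.
move=> add [L regL H]; apply: reg_regular.
have : reg (fun w : seq (d.-tuple (option Sigma)) =>
    (ohead w <> Some (tuple_letter (blank 'I_d)) /\ L (map (@letter_tuple d) w)) /\
    forall i, valid_track (map (fun a => tnth a i) w)).
  apply: reg_and; first apply: reg_and.
  - exact: (@reg_ohead _ (fun o => o <> Some (tuple_letter (blank 'I_d)))).
  - exact: reg_preim.
  - by apply: reg_forall => i; apply: reg_preim; apply: reg_valid_track.
have trE (w : seq (letter 'I_d)) i :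
    map (fun a => tnth a i) (map (@tuple_letter d) w) = track i w.
  by rewrite -map_comp; apply: eq_map => a; rewrite /= tnth_mktuple.
apply: reg_ext => w; split=> [[[hw Lw] vw]|[t [Rt ->]]].
  have [e He] := choice vw.
  have [em E] : fits (size (map (@letter_tuple d) w)) e /\
      map (@letter_tuple d) w = conv (size (map (@letter_tuple d) w)) e.
    apply: conv_of_tracks => i; have [k Ek] := He i; exists k.
    by rewrite -Ek -trE mapK //; apply: letter_tupleK.
  exists (mktuple e); rewrite -(strip_conv em) -E mapK; last exact: letter_tupleK.
  rewrite strip_ohead //; split=> //.
  have -> : tnth (mktuple e) = e by apply/funext=> i; rewrite tnth_mktuple.
  by apply/(H _ _ em); rewrite -E.
have fM := @fits_max _ (tnth t).
split=> [|i]; last first.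
  rewrite rep_tuple_conv trE track_conv //.
  by exists (tnth t i); eexists.
split; first exact: ohead_rep_tuple.
rewrite rep_tuple_conv mapK; first exact/H.
by move=> a; apply/ffunP=> i; rewrite ffunE tnth_mktuple.
Qed.

(** Addability speaks of canonical words only; stripping extends it to all paddings. Reindexing
    along [f] lets [u], [v] and [w] coincide. *)
Lemma rec_add (V : finType) (u v w : V) :
  injective rep -> addable rep -> rec (fun e => e w = e u + e v).
Proof.
move=> inj_rep add.
have base : rec (fun e : 'I_3 -> nat => e ord_max = e ord0 + e (lift ord0 ord0)).
  have [L H] : exists2 L, reg L & forall t : 3.-tuple nat,
      nth 0 t 2 = nth 0 t 0 + nth 0 t 1 <-> L (rep_tuple rep t).
    eexists; first exact: regular_reg add.
    move=> t; split=> [Ht|]; first by exists t.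
    by move=> [t' [Ht' /(rep_tuple_inj inj_rep)->]].
  move=> HL.
  exists (fun w => L (strip (tuple_letter (blank 'I_3)) (map (@tuple_letter 3) w))).
    exact: reg_preim (reg_strip _ H).
  move=> e m em /=; rewrite strip_conv // -HL.
  by rewrite -(tnth_nth 0 _ ord0) -(tnth_nth 0 _ ord_max)
    -(tnth_nth 0 _ (lift ord0 ord0)) !tnth_mktuple.
pose f (i : 'I_3) := nth u [:: u; v; w] i.
by have := rec_reindex f base.
Qed.

(** * Order and letters of automatic words *)

Section Arithmetic.
Hypotheses (inj_rep : injective rep) (add : addable rep).
Variable V : finType.
Implicit Types u v : V.

Lemma rec_leq u v : rec (fun e => e u <= e v).
Proof.
have := rec_exists1 add (@rec_add (V + unit)%type (inl u) (inr tt) (inl v) inj_rep add).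
apply: rec_ext => e /=; split=> [[p ->]|uv]; first exact: leq_addr.
by exists (e v - e u); rewrite subnKC.
Qed.

Lemma rec_ltn u v : rec (fun e => e u < e v).
Proof.
apply: rec_ext (rec_not (rec_leq v u)) => e.
by rewrite ltnNge; split=> /negP.
Qed.

Lemma rec_eq u v : rec (fun e => e u = e v).
Proof.
apply: rec_ext (rec_and (rec_leq u v) (rec_leq v u)) => e; split; last by move=> ->.
by move=> /andP; rewrite -eqn_leq => /eqP.
Qed.

Lemma rec_letter (A : finType) (x : nat -> A) v a :
  automatic rep x -> rec (fun e => x (e v) = a).
Proof.
move=> [n [q0 [d [tau H]]]].
(* Padding leaves the state unchanged. *)
pose D q (c : option Sigma) := if c is Some s then d q s else q.
exists (fun w => tau (foldl D q0 (track v w)) = a).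
  apply: (@reg_preim _ _ (fun b : letter V => b v) (fun w => tau (foldl D q0 w) = a)).
  exists 'I_n.+1, q0, D, (fun q => tau q == a) => w.
  by split=> /eqP.
move=> e m em; rewrite track_conv // -H /pad foldl_cat.
have -> k : foldl D q0 (nseq k None) = q0 by elim: k.
suff -> : foldl D q0 (map Some (rep (e v))) = foldl d q0 (rep (e v)) by [].
by elim/last_ind: (rep (e v)) => // w c IH; rewrite map_rcons !foldl_rcons IH.
Qed.

End Arithmetic.
End Convolution.

(** * Definability of the winning game *)

Definition agree (A : Type) (x : nat -> A) n i i' :=
  forall j, j < n -> x (i + j) = x (i' + j).

Lemma agree_sym (A : Type) (x : nat -> A) n i i' : agree x n i i' -> agree x n i' i.
Proof. by move=> H j /H. Qed.

(* Only the rounds listed in [s] offer a choice; [x[i..i+n)] is Bob's word so far,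
   and in between two choices Alice may move to any other occurrence of it. *)
Fixpoint game (A : finType) (x : nat -> A) (alpha : nat -> nat) (s : seq nat) n i : Prop :=
  if s is p :: s' then
    exists i0, agree x n i0 i /\ exists B : {set A}, #|B| = (alpha p).+1 /\
      forall b, b \in B -> exists i', [/\ agree x p i' i0, x (i' + p) = b &
        game x alpha s' p.+1 i']
  else True.

(** * Completing partial plays *)

Section Strategies.
Variables (A : finType) (sigma : seq A -> {set A}).
Hypothesis sigma_neq0 : forall h, 0 < #|sigma h|.

Definition consistent n (a : nat -> A) :=
  forall j, j < n -> a j \in sigma (mkseq a j).

(** All offered sets are nonempty, so from round [n] on a choice function can answer for Bob. *)
Lemma extend_play n a : consistent n a ->
  exists2 a', (forall j, j < n -> a' j = a j) & forall j, a' j \in sigma (mkseq a' j).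
Proof.
move=> cons_a.
have /choice[c Hc] : forall h, exists b, b \in sigma h.
  by move=> h; apply/card_gt0P.
pose step h := rcons h (if size h < n then a (size h) else c h).
pose H k := iter k step [::].
have sizeH k : size (H k) = k by elim: k => //= k IH; rewrite size_rcons IH.
pose a' k := nth (a 0) (H k.+1) k.
have a'E k : a' k = if k < n then a k else c (H k).
  by rewrite /a' /= /step nth_rcons sizeH ltnn eqxx.
have HE k : H k = mkseq a' k.
  elim: k => // k IH; rewrite mkseqS -IH a'E /= /step -/(H k).
  by rewrite sizeH.
have a'a j : j < n -> a' j = a j by move=> jn; rewrite a'E jn.
exists a' => // j; rewrite -HE a'E; case: ltnP => // jn; rewrite HE.
rewrite (_ : mkseq a' j = mkseq a j) ?cons_a //.
apply/eq_in_map => k; rewrite mem_iota => /andP[_ kj]; apply: a'a.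
by apply: ltn_trans jn.
Qed.

Lemma extend_play_at n a b : consistent n a -> b \in sigma (mkseq a n) ->
  exists a', [/\ forall j, j < n -> a' j = a j, a' n = b &
    forall j, a' j \in sigma (mkseq a' j)].
Proof.
move=> cons_a bB; pose a1 j := if j < n then a j else b.
have a1E j : j <= n -> mkseq a1 j = mkseq a j.
  move=> jn; apply/eq_in_map => k; rewrite mem_iota => /andP[_ kj].
  by rewrite /a1 (leq_trans kj jn).
have [|a' a'1 Ha'] := @extend_play n.+1 a1.
  move=> j; rewrite ltnS => jn; rewrite a1E // /a1; case: ltnP => [/cons_a//|nj].
  by have /eqP-> : j == n by rewrite eqn_leq jn.
exists a'; split=> // [j jn|]; last by rewrite a'1 // /a1 ltnn.
by rewrite a'1 /a1 ?jn // ltnW.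
Qed.

End Strategies.

(** * The game with finitely many choice rounds *)

Section Game.
Variables (A : finType) (x : nat -> A) (alpha : nat -> nat).
Local Notation X := (orbit_closure x).

(** A play consistent with the winning strategy lies in the orbit closure, so each of its prefixes
    occurs in [x]. The positions demanded by [game] are such occurrences. *)
Lemma game_of_strategy (sigma : seq A -> {set A}) s n i :
  (forall h, #|sigma h| = (alpha (size h)).+1) ->
  (forall a, (forall j, a j \in sigma (mkseq a j)) -> X a) ->
  sorted ltn s -> (forall p, p \in s -> n <= p) ->
  consistent sigma n (fun j => x (i + j)) -> game x alpha s n i.
Proof.
move=> card_s win_s; have ne h : 0 < #|sigma h| by rewrite card_s.
elim: s n i => //= p s IH n i ps ns cons_i.
have [a ai Ha] := extend_play ne cons_i.
have [i0 Hi0] := win_s a Ha p.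
exists i0; split.
  by move=> j jn; rewrite -Hi0 ?ai // (leq_trans jn) // ns ?mem_head.
exists (sigma (mkseq a p)); split; first by rewrite card_s size_mkseq.
move=> b bB; have cons_a : consistent sigma p a by move=> j _; apply: Ha.
have [a' [a'a a'p Ha']] := extend_play_at ne cons_a bB.
(* One letter more than for [i0], since the occurrence must also show [b] at [p]. *)
have [i' Hi'] := win_s a' Ha' p.+1.
exists i'; split.
- by move=> j jp; rewrite -(Hi' j (ltnW jp)) a'a // Hi0.
- by rewrite -Hi' // a'p.
apply: IH => [||j].
- exact: path_sorted ps.
- by move=> q qs; move: ps => /(order_path_min ltn_trans)/allP/(_ _ qs).
move=> jp; rewrite -Hi' // (_ : mkseq _ j = mkseq a' j); first exact: Ha'.
apply/eq_in_map => k; rewrite mem_iota => /andP[_ kj].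
by rewrite Hi' // (leq_trans kj) // ltnW.
Qed.

(** Alice dictates the letters of [x] from [i0] up to round [p], offers [B] there, and then follows
    the strategy attached to Bob's answer. Once no choice is left she dictates a tail of [x], which
    lies in the orbit closure. *)
Lemma strategy_of_game s n i :
  sorted ltn s -> (forall p, p \in s -> n <= p) ->
  (forall j, n <= j -> j \notin s -> alpha j = 0) ->
  game x alpha s n i ->
  exists sigma : seq A -> {set A},
    (forall h, n <= size h -> #|sigma h| = (alpha (size h)).+1) /\
    forall a, (forall j, j < n -> a j = x (i + j)) ->
      (forall j, n <= j -> a j \in sigma (mkseq a j)) -> X a.
Proof.
elim: s n i => [|p s IH] n i.
  move=> _ _ alpha0 _; exists (fun h => [set x (i + size h)]); split.
    by move=> h nh; rewrite cards1 alpha0.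
  move=> a ai Ha m; exists i => j _; case: (ltnP j n) => [/ai//|/Ha].
  by rewrite inE size_mkseq => /eqP.
move=> ps ns alpha0 [i0 [ii0 [B [cardB HB]]]].
have np : n <= p by apply: ns; rewrite mem_head.
have sp q : q \in s -> p < q.
  by move: ps => /(order_path_min ltn_trans)/allP/[apply].
have /choice[f Hf] : forall b, exists i'sig : nat * (seq A -> {set A}), b \in B ->
    [/\ agree x p i'sig.1 i0, x (i'sig.1 + p) = b,
     forall h, p.+1 <= size h -> #|i'sig.2 h| = (alpha (size h)).+1 &
     forall a, (forall j, j < p.+1 -> a j = x (i'sig.1 + j)) ->
      (forall j, p.+1 <= j -> a j \in i'sig.2 (mkseq a j)) -> X a].
  move=> b; case: (boolP (b \in B)) => [bB|_]; last by exists (0, fun=> set0).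
  have [i' [i'i0 i'b /IH[]//]] := HB b bB; first exact: path_sorted ps.
    move=> j pj js; apply: alpha0; first by apply: leq_trans np (ltnW pj).
    by rewrite inE negb_or js andbT gtn_eqF.
  by move=> sg [? ?]; exists (i', sg).
pose b0 := x 0.
have [b1 b1B] : exists b, b \in B by apply/card_gt0P; rewrite cardB.
(* The size condition concerns all histories, also those whose letter at [p] is outside [B]; the
   strategy for [b1] serves them. The letter [b0] is only a default for [nth]. *)
pose sigma (h : seq A) := if size h < p then [set x (i0 + size h)]
  else if size h == p then B else
  if nth b0 h p \in B then (f (nth b0 h p)).2 h else (f b1).2 h.
exists sigma; split.
  move=> h nh; rewrite /sigma; case: (ltngtP (size h) p) => [hp|hp|->] //.
    rewrite cards1 alpha0 // inE negb_or ltn_eqF //=.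
    by apply/negP=> /sp; rewrite ltnNge ltnW.
  by case: ifP => [/Hf[]|_]; [|case: (Hf _ b1B)] => _ _ ->.
move=> a ai Ha.
have ai0 j : j < p -> a j = x (i0 + j).
  move=> jp; case: (ltnP j n) => [jn|/Ha]; first by rewrite ai // -ii0.
  by rewrite /sigma size_mkseq jp inE => /eqP.
have apB : a p \in B by have := Ha p np; rewrite /sigma size_mkseq ltnn eqxx.
have [i'i0 i'b _] := Hf _ apB; apply.
  move=> j; rewrite ltnS leq_eqVlt => /predU1P[->|jp]; first by rewrite i'b.
  by rewrite i'i0 // ai0.
move=> j pj; have := Ha j (leq_trans np (ltnW pj)).
by rewrite /sigma size_mkseq ltnNge (ltnW pj) /= gtn_eqF // nth_mkseq // apB.
Qed.

Lemma winning_shift_game s : sorted ltn s -> (forall j, j \notin s -> alpha j = 0) ->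
  winning_shift X alpha <-> exists i, game x alpha s 0 i.
Proof.
move=> sorted_s alpha0; split=> [[_ [sigma [card_s win_s]]]|[i Hg]].
  by exists 0; apply: game_of_strategy card_s win_s sorted_s _ _.
have [||sigma [card_s win_s]] := strategy_of_game sorted_s _ _ Hg.
- by [].
- by move=> j _; apply: alpha0.
split=> [j|].
  (* Any history of length [j] is offered [alpha j + 1] letters of [A], which bounds [alpha j]. *)
  have := card_s (nseq j (x 0)) isT; rewrite size_nseq => <-.
  exact: max_card.
by exists sigma; split=> [h|a Ha]; [apply: card_s | apply: win_s].
Qed.

End Game.

(** * Recognizability of the game formula *)

Section Definability.
Variables (Sigma : finType) (rep : nat -> seq Sigma).
Hypotheses (inj_rep : injective rep) (add : addable rep).
Variables (A : finType) (x : nat -> A).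
Hypothesis auto_x : automatic rep x.

Lemma rec_forall_var (V S : finType) (R : (V + S -> nat) -> Prop) :
  rec rep R -> rec rep (fun e => forall p, R (sum_env e p)).
Proof.
move=> /rec_not/(rec_exists add)/rec_not; apply: rec_ext => e; split.
  by move=> nE p; apply: contrapT => nR; apply: nE; exists p.
by move=> H [p]; apply.
Qed.

Lemma rec_eq_letter (V : finType) (i i' : V) : rec rep (fun e => x (e i) = x (e i')).
Proof.
have : rec rep (fun e : V -> nat => forall a, x (e i) = a -> x (e i') = a).
  by apply: rec_forall => a; apply: rec_imply; apply: rec_letter.
by apply: rec_ext => e; split=> [/(_ _ erefl)->|-> a].
Qed.

Lemma rec_eq_letter_add (V : finType) (i i' j : V) :
  rec rep (fun e => x (e i + e j) = x (e i' + e j)).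
Proof.
have : rec rep (fun e : V -> nat => forall p : bool -> nat,
    p true = e i + e j -> p false = e i' + e j -> x (p true) = x (p false)).
  apply: (@rec_forall_var V bool (fun e => e (inr true) = e (inl i) + e (inl j) ->
    e (inr false) = e (inl i') + e (inl j) -> x (e (inr true)) = x (e (inr false)))).
  apply: rec_imply; first exact: rec_add.
  apply: rec_imply; first exact: rec_add.
  exact: rec_eq_letter.
apply: rec_ext => e; split=> [H|H p -> ->] //.
exact: (H (fun b : bool => if b then e i + e j else e i' + e j)).
Qed.

Lemma rec_letter_add (V : finType) (i j : V) a :
  rec rep (fun e => x (e i + e j) = a).
Proof.
have : rec rep (fun e : V -> nat => exists p : nat, p = e i + e j /\ x p = a).
  apply: (@rec_exists1 _ _ V
    (fun e => e (inr tt) = e (inl i) + e (inl j) /\ x (e (inr tt)) = a) add).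
  by apply: rec_and; [exact: rec_add | exact: rec_letter].
by apply: rec_ext => e; split=> [[_ [->]]|H] //; eexists.
Qed.

Lemma rec_agree (V : finType) (n i i' : V) :
  rec rep (fun e => agree x (e n) (e i) (e i')).
Proof.
have : rec rep (fun e : V -> nat => forall p : unit -> nat,
    p tt < e n -> x (e i + p tt) = x (e i' + p tt)).
  apply: (@rec_forall_var V unit (fun e => e (inr tt) < e (inl n) ->
    x (e (inl i) + e (inr tt)) = x (e (inl i') + e (inr tt)))).
  by apply: rec_imply; [exact: rec_ltn | exact: rec_eq_letter_add].
apply: rec_ext => e; split=> [H j|H p]; last exact: H.
exact: (H (fun=> j)).
Qed.

(** The length of Bob's word at a choice is 0 or the successor of the last choice position; the
    option expresses both with variables alone. *)
Definition after (V : Type) (prev : option V) (e : V -> nat) :=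
  if prev is Some v then (e v).+1 else 0.

Lemma rec_agree_after (V : finType) (prev : option V) (i i' : V) :
  rec rep (fun e => agree x (after prev e) (e i) (e i')).
Proof.
case: prev => [v|] /=; last by apply: rec_ext (rec_const _ _ True).
apply: rec_ext (rec_and (rec_agree v i i') (rec_eq_letter_add i i' v)) => e.
split=> [[H Hv] j|H].
  by rewrite ltnS leq_eqVlt => /predU1P[->|/H].
by split=> [j jv|]; apply: H => //; apply: ltnW.
Qed.

(** The inverse of the coding [nu_of], as the cardinality of a set so that [rec_set_of] applies. *)
Definition multiplicity (K : finType) (t : K -> nat) p := #|[set k | `[< t k = p >]]|.

(** Each choice round introduces two position variables. The map [f] carries the original variables
    into the growing context, and [prev] is the last choice position. *)
Lemma rec_game (K V : finType) (f : K -> V) (us : seq K) (prev : option V) (i : V) :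
  rec rep (fun e => game x (multiplicity (e \o f)) (map (e \o f) us) (after prev e) (e i)).
Proof.
elim: us V f prev i => [|u us IH] V f prev i /=; first exact: rec_const.
(* [V1] adds the variable for [i0], and [V2] the one for [i']. *)
pose V1 := (V + unit)%type; pose V2 := (V1 + unit)%type.
apply: (@rec_exists1 _ _ V (fun e => agree x (after prev (e \o inl)) (e (inr tt)) (e (inl i)) /\
   exists B : {set A}, #|B| = (multiplicity (e \o inl \o f) (e (inl (f u)))).+1 /\
   forall b, b \in B -> exists i', [/\ agree x (e (inl (f u))) i' (e (inr tt)),
     x (i' + e (inl (f u))) = b &
     game x (multiplicity (e \o inl \o f)) (map (e \o inl \o f) us) (e (inl (f u))).+1 i']) add).
apply: rec_and.
  by case: prev => [v|]; [have := rec_agree_after (Some (inl v : V1)) (inr tt) (inl i)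
    | have := rec_agree_after (None : option V1) (inr tt) (inl i)].
apply: rec_exists_fin => B; apply: rec_and.
  apply: (@rec_set_of _ _ V1 K (fun k e => e (inl (f k)) = e (inl (f u)))
    (fun E => #|B| = #|E|.+1)).
  by move=> k; apply: rec_eq.
apply: rec_forall => b; apply: rec_imply; first exact: rec_const.
apply: (@rec_exists1 _ _ V1 (fun e =>
  [/\ agree x (e (inl (inl (f u)))) (e (inr tt)) (e (inl (inr tt))),
     x (e (inr tt) + e (inl (inl (f u)))) = b &
     game x (multiplicity (e \o inl \o inl \o f)) (map (e \o inl \o inl \o f) us)
       (e (inl (inl (f u)))).+1 (e (inr tt))]) add).
have := rec_and (rec_agree (inl (inl (f u)) : V2) (inr tt) (inl (inr tt)))
  (rec_and (rec_letter_add (inr tt : V2) (inl (inl (f u))) b)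
     (IH V2 (inl \o inl \o f) (Some (inl (inl (f u)))) (inr tt))).
by apply: rec_ext => e; split=> [[? []]|[]].
Qed.

Lemma rec_sorted (V : finType) (r : rel nat) (us : seq V) :
  (forall u v, rec rep (fun e : V -> nat => r (e u) (e v))) ->
  rec rep (fun e => sorted r (map e us)).
Proof.
move=> rec_r; case: us => [|u us] /=; first exact: rec_const.
elim: us u => [|v us IH] u /=; first exact: rec_const.
by apply: rec_ext (rec_and (rec_r u v) (IH v)) => e; split=> /andP.
Qed.

Lemma multiplicity_count d (t : d.-tuple nat) j :
  multiplicity (tnth t) j = count_mem j t.
Proof.
rewrite /multiplicity -sum1_card -sum1_count big_tuple /=.
by apply: eq_bigl => k; rewrite inE; apply/asboolP/eqP.
Qed.

(** The game needs the distinct entries of [t] in increasing order. Some list [us] of coordinates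
    enumerates them, and there are finitely many candidates, so the choice of [us] is a finite
    disjunction. *)
Lemma rec_winning_shift d : recognizable rep (fun t : d.-tuple nat =>
  sorted leq t /\ winning_shift (orbit_closure x) (fun j => count_mem j t)).
Proof.
have : recognizable rep (fun t : d.-tuple nat => sorted leq (map (tnth t) (enum 'I_d)) /\
    exists r : 'I_d.+1, exists us : r.-tuple 'I_d, sorted ltn (map (tnth t) us) /\
    (forall k, exists l, l \in us /\ tnth t l = tnth t k) /\
    exists i, game x (multiplicity (tnth t)) (map (tnth t) us) 0 i).
  apply: (@rec_recognizable _ _ d (fun e => sorted leq (map e (enum 'I_d)) /\
    exists r : 'I_d.+1, exists us : r.-tuple 'I_d, sorted ltn (map e us) /\
    (forall k, exists l, l \in us /\ e l = e k) /\
    exists i, game x (multiplicity e) (map e us) 0 i) add).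
  apply: rec_and; first by apply: rec_sorted => u v; apply: rec_leq.
  apply: rec_exists_fin => r; apply: rec_exists_fin => us.
  apply: rec_and; first by apply: rec_sorted => u v; apply: rec_ltn.
  apply: rec_and.
    apply: rec_forall => k; apply: rec_exists_fin => l.
    by apply: rec_and; [exact: rec_const | exact: rec_eq].
  apply: (@rec_exists1 _ _ _ (fun e : 'I_d + unit -> nat => game x (multiplicity (e \o inl))
    (map (e \o inl) us) 0 (e (inr tt))) add).
  by have := rec_game (inl : 'I_d -> 'I_d + unit) us None (inr tt).
congr (recognizable rep _); apply/funext=> t; apply/propext.
have mulE : multiplicity (tnth t) = fun j => count_mem j t.
  by apply/funext=> j; rewrite multiplicity_count.
rewrite map_tnth_enum mulE.
have count0 (s : seq nat) j : t =i s -> j \notin s -> count_mem j t = 0.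
  by move=> ts; rewrite -ts => /count_memPn.
split=> [[sorted_t [r [us [sorted_us [cover Hg]]]]]|[sorted_t Hw]]; split=> //.
  suff alpha0 j : j \notin map (tnth t) us -> count_mem j t = 0.
    exact/(@winning_shift_game _ x _ _ sorted_us alpha0).
  apply: count0 => q; apply/tnthP/mapP => [[k ->]|[l _ ->]]; last by exists l.
  by have [l [lus <-]] := cover k; exists l.
have : sorted ltn (undup t).
  by rewrite ltn_sorted_uniq_leq undup_uniq (subseq_sorted leq_trans (undup_subseq t)).
have [us Eus] : exists us, map (tnth t) us = undup t.
  have: {subset undup t <= t} by move=> q; rewrite mem_undup.
  elim: (undup t) => [|q s IH] sub; first by exists [::].
  have /tnthP[k ->] := sub q (mem_head q s).
  by have [p ps|us <-] := IH; [apply: sub; rewrite inE ps orbT | exists (k :: us)].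
have size_us : size us < d.+1.
  by rewrite -(size_map (tnth t)) Eus ltnS -[leqRHS](size_tuple t) size_undup.
rewrite -Eus => sorted_us; exists (Ordinal size_us), (in_tuple us); split=> //.
split=> [k|].
  have : tnth t k \in map (tnth t) us by rewrite Eus mem_undup mem_tnth.
  by case/mapP=> l lus ->; exists l.
have alpha0 j : j \notin map (tnth t) us -> count_mem j t = 0.
  by apply: count0 => q; rewrite Eus mem_undup.
exact/(@winning_shift_game _ x _ _ sorted_us alpha0).
Qed.

End Definability.

(** * Right special factors *)

Section Complexity.
Variables (A : finType) (x : nat -> A).

Definition fac i m : m.-tuple A := [tuple x (i + k) | k < m].

Lemma fac_agree i i' m : fac i m = fac i' m <-> agree x m i i'.
Proof.
split=> [E j jm|E]; last by apply: eq_from_tnth => j; rewrite !tnth_mktuple E.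
by have := congr1 (fun t => tnth t (Ordinal jm)) E; rewrite !tnth_mktuple.
Qed.

Lemma val_fac i m : val (fac i m) = factor_at x i m.
Proof. by rewrite /factor_at -val_enum_ord -map_comp. Qed.

Definition factors m := [set w : m.-tuple A | `[< exists i, w = fac i m >]].

Lemma rhoE m : rho x m = #|factors m|.
Proof.
apply: eq_card => w; rewrite !inE.
by apply: asbool_equiv_eq; split=> -[i E]; exists i; [apply/val_inj|];
  rewrite ?val_fac // E val_fac.
Qed.

Lemma card_le_rho (I : finType) (D : {set I}) (f : I -> nat) m :
  (forall a b, a \in D -> b \in D -> agree x m (f a) (f b) -> a = b) ->
  #|D| <= rho x m.
Proof.
move=> inj_f; rewrite rhoE -(@card_in_imset _ _ (fun a => fac (f a) m)) => [|a b aD bD].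
  apply/subset_leq_card/subsetP=> w /imsetP[a _ ->].
  by rewrite inE; apply/asboolP; exists (f a).
by move=> /fac_agree; apply: inj_f.
Qed.

Definition right_special m := [set w : m.-tuple A | `[< exists i i',
  [/\ w = fac i m, w = fac i' m & x (i + m) <> x (i' + m)] >]].

Lemma right_specialP m w : reflect
  (exists i i', [/\ w = fac i m, w = fac i' m & x (i + m) <> x (i' + m)])
  (w \in right_special m).
Proof. by rewrite inE; apply: asboolP. Qed.

(** Every factor of length [m] has an extension by one letter ([S1]), and every right special one
    has a second, different extension ([S2]). *)
Lemma rho_succ m : #|right_special m| + rho x m <= rho x m.+1.
Proof.
have /choice[o /all_and2[Ho1 Ho2]] : forall w : m.-tuple A, exists oo : nat * nat,
    (w \in factors m -> w = fac oo.1 m) /\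
    (w \in right_special m -> w = fac oo.2 m /\ x (oo.1 + m) <> x (oo.2 + m)).
  move=> w; case: (right_specialP w) => [[i [i' [E E' ne]]]|_].
    by exists (i, i').
  case: (boolP (w \in factors m)) => [|_]; last by exists (0, 0).
  by rewrite inE => /asboolP[i E]; exists (i, 0).
have facW i i' : fac i m.+1 = fac i' m.+1 -> fac i m = fac i' m /\ x (i + m) = x (i' + m).
  by move=> /fac_agree H; split; [apply/fac_agree => j jm; apply/H/ltnW | apply: H].
pose S1 := [set fac (o w).1 m.+1 | w in factors m].
pose S2 := [set fac (o w).2 m.+1 | w in right_special m].
have cardS1 : #|S1| = #|factors m|.
  apply: card_in_imset => w w' /Ho1 E /Ho1 E' /facW[].
  by rewrite -E -E'.
have cardS2 : #|S2| = #|right_special m|.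
  apply: card_in_imset => w w' /Ho2[E _] /Ho2[E' _] /facW[].
  by rewrite -E -E'.
have disj : S1 :&: S2 = set0.
  apply/setP=> u; rewrite !inE; apply/negP=> /andP[/imsetP[w /Ho1 E ->]].
  move=> /imsetP[w' /Ho2[E' ne] /facW[]].
  by rewrite -E -E' => ww' Ex; apply: ne; rewrite -Ex ww'.
rewrite !rhoE addnC -cardS1 -cardS2 -cardsUI disj cards0 addn0.
apply/subset_leq_card/subsetP=> u; rewrite inE => /orP[]/imsetP[w _ ->].
  by rewrite inE; apply/asboolP; eexists.
by rewrite inE; apply/asboolP; eexists.
Qed.

Lemma sum_right_special h n : h <= n ->
  \sum_(h <= m < n) #|right_special m| <= rho x n.
Proof.
elim: n => [|n IH]; first by move=> _; rewrite big_geq.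
rewrite leq_eqVlt => /predU1P[->|hn]; first by rewrite big_geq.
rewrite big_nat_recr //= addnC; apply: leq_trans (rho_succ n).
by rewrite leq_add2l IH.
Qed.

(** Averaging: at least [n / 2] lengths, each with more than [2 * C] special words, would by
    [sum_right_special] give more than [C * n] factors of length [n]. *)
Lemma few_right_special C n : 0 < n -> rho x n <= C * n ->
  exists l, [/\ n./2 <= l, l < n & #|right_special l| <= 2 * C].
Proof.
move=> n0 rhon; apply: contrapT => noL.
have hn : n./2 <= n by lia.
have : \sum_(n./2 <= m < n) (2 * C).+1 <= C * n.
  apply: leq_trans rhon; apply: leq_trans (sum_right_special hn).
  rewrite big_nat [leqRHS]big_nat; apply: leq_sum => m /andP[hm mn].
  by rewrite ltnNge; apply/negP=> small; apply: noL; exists m.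
rewrite sum_nat_const_nat leqNgt => /negP; apply.
have : n <= 2 * (n - n./2) by lia.
move: (n - n./2) => k nk; apply: (@leq_ltn_trans (C * (2 * k))).
  by rewrite leq_mul2l nk orbT.
lia.
Qed.

(* [x[q..q+l]] (of length [l + 1]) has no period at most [l / 2]. A right special
   word of length [l] has at most one extension that fails this. *)
Definition aperiodic l q := forall D, 0 < D -> 2 * D <= l ->
  ~ (forall i, i + D <= l -> x (q + (i + D)) = x (q + i)).

(** As in the theorem of Fine and Wilf: if the two extensions have periods [D] and [E], both last
    letters equal the common letter at [l - D - E], a legal position because [D + E <= l]. *)
Lemma aperiodic_extension l q q' : agree x l q q' -> x (q + l) <> x (q' + l) ->
  aperiodic l q \/ aperiodic l q'.
Proof.
move=> qq' ne; apply: contrapT => /not_orP[nq nq']; apply: ne.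
have per p : ~ aperiodic l p -> exists D, [/\ 0 < D, 2 * D <= l &
    forall i, i + D <= l -> x (p + (i + D)) = x (p + i)].
  move=> np; apply: contrapT => nE; apply: np => D D0 Dl HD; apply: nE.
  by exists D.
have [D [D0 Dl HD]] := per q nq; have [E [E0 El HE]] := per q' nq'.
rewrite -{1}(@subnK D l) ?HD ?subnK; try lia.
rewrite -{2}(@subnK E l) ?HE ?subnK; try lia.
rewrite qq'; last lia.
rewrite -{1}(@subnK E (l - D)) ?HE ?subnK; try lia.
rewrite -qq'; last lia.
have -> : l - D - E = l - E - D by lia.
rewrite -HD ?subnK ?qq'; lia || done.
Qed.

(** A second occurrence of the word of length [l] at distance [D] gives [x[q..q+l]] the period
    [D]. *)
Lemma aperiodic_separated l q D : aperiodic l q -> 0 < D -> agree x l q (q + D) -> l < 2 * D.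
Proof.
move=> ap D0 ag; rewrite ltnNge; apply/negP=> Dl; apply: (ap D D0 Dl) => i il.
by rewrite (ag i); [congr x; lia | lia].
Qed.

(* Sliding a window of length [2 n] over the chosen occurrences [o w] produces
   pairwise distinct factors; only an occurrence near the origin lacks room. *)
Lemma special_fiber (I : finType) (D : {set I}) (o : I -> nat) l n :
  l <= n ->
  (forall a b, a \in D -> b \in D -> agree x n (o a) (o b) -> a = b) ->
  (forall a b, a \in D -> b \in D -> agree x l (o a + (n - l)) (o b + (n - l))) ->
  (forall a, a \in D -> aperiodic l (o a + (n - l))) ->
  #|D|.-1 * l./2 <= rho x (2 * n).
Proof.
move=> ln inj_o suf ap; pose D' := [set a in D | l./2 <= o a].
(* Two occurrences without room would place two copies of the common suffix less than [l / 2]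
   apart. *)
have cardD' : #|D|.-1 <= #|D'|.
  have : #|D :\: D'| <= 1.
    apply/card_le1_eqP => a b; rewrite !inE !negb_and -!ltnNge.
    wlog ab : a b / o a <= o b.
      move=> W Da Db; case: (leqP (o a) (o b)) => [|/ltnW] ab; first exact: W.
      by apply/esym; apply: W.
    move=> /andP[/orP[/negbTE->//|oa] aD] /andP[/orP[/negbTE->//|ob] bD].
    apply: inj_o => //; case: (posnP (o b - o a)) => [E|gap].
      by have -> : o a = o b by lia.
    have := aperiodic_separated (ap a aD) gap.
    have -> : o a + (n - l) + (o b - o a) = o b + (n - l) by lia.
    by move/(_ (suf a b aD bD)); lia.
  have sD : D' \subset D by apply/subsetP=> a; rewrite inE => /andP[].
  by rewrite cardsDS //; lia.
apply: (@leq_trans (#|D'| * l./2)); first by rewrite leq_mul2r cardD' orbT.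
have -> : #|D'| * l./2 = #|setX D' [set: 'I_(l./2)]| by rewrite cardsX cardsT card_ord.
apply: (@card_le_rho _ _ (fun p : I * 'I_(l./2) => o p.1 - p.2)) => -[a j] [b k].
rewrite !inE /= !andbT => /andP[aD oa] /andP[bD ob].
(* If windows with shifts [j1 < k1] agreed, the common suffix would reappear [k1 - j1] to the right
   of its place at [a1], too close for an aperiodic word. *)
have window a1 b1 (j1 k1 : 'I_(l./2)) : a1 \in D -> b1 \in D ->
    l./2 <= o a1 -> l./2 <= o b1 -> j1 < k1 ->
    ~ agree x (2 * n) (o a1 - j1) (o b1 - k1).
  move=> a1D b1D oa1 ob1 jk ag; have ltk := ltn_ord k1.
  have := @aperiodic_separated _ _ (k1 - j1) (ap a1 a1D).
  rewrite subn_gt0 => /(_ jk); suff H : agree x l (o a1 + (n - l)) (o a1 + (n - l) + (k1 - j1)).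
    by move/(_ H); lia.
  move=> i il; rewrite (suf a1 b1 a1D b1D i il).
  have := ag (k1 + (n - l) + i).
  have -> : o a1 - j1 + (k1 + (n - l) + i) = o a1 + (n - l) + (k1 - j1) + i by lia.
  have -> : o b1 - k1 + (k1 + (n - l) + i) = o b1 + (n - l) + i by lia.
  by move=> -> //; lia.
move=> ag; have ltj := ltn_ord j.
case: (ltngtP j k) => [jk|kj|jk]; first by case: (window _ _ _ _ aD bD oa ob jk).
  by case: (window _ _ _ _ bD aD ob oa kj); apply: agree_sym.
have Ejk : j = k by apply: val_inj.
rewrite -{}Ejk {jk} in ag *; congr (_, _); apply: inj_o => // i i_n.
have := ag (j + i).
have -> : o a - j + (j + i) = o a + i by lia.
have -> : o b - j + (j + i) = o b + i by lia.
by move=> -> //; lia.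
Qed.

(* Cassaigne's theorem: some length [l] in [n/2, n) has at most [2 C] special words,
   and boundedly many special words of length [n] share a suffix of length [l]. *)
Lemma right_special_bounded C : (forall n, 0 < n -> rho x n <= C * n) ->
  exists K, forall n, #|right_special n| <= K.
Proof.
(* At most [2 * C] special suffixes, each shared by at most [16 * C + 1] words; [4 * C] covers the
   lengths below 4. *)
move=> rhoC; exists (2 * C * (16 * C + 1) + 4 * C) => n.
case: (ltnP n 4) => [n4|n4].
  apply: leq_trans (leq_addl _ _); apply: leq_trans (leq_addr (rho x n) _) _.
  apply: leq_trans (rho_succ n) _; apply: leq_trans (rhoC n.+1 isT) _.
  by rewrite mulnC leq_mul2r n4 orbT.
have n0 : 0 < n by lia.
have [l [nl ln fewl]] := few_right_special n0 (rhoC n n0).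
(* Of two occurrences of [w] followed by different letters, one has an aperiodic extended suffix;
   [o] selects it. *)
have /choice[o Ho] : forall w : n.-tuple A, exists i, w \in right_special n ->
    [/\ w = fac i n, fac (i + (n - l)) l \in right_special l & aperiodic l (i + (n - l))].
  move=> w; case: (right_specialP w) => [[i [i' [E E' ne]]]|_]; last by exists 0.
  have ag : agree x l (i + (n - l)) (i' + (n - l)).
    move=> j jl; have /fac_agree H := etrans (esym E) E'.
    by rewrite -!addnA; apply: H; lia.
  have El k : k + (n - l) + l = k + n by lia.
  have ne' : x (i + (n - l) + l) <> x (i' + (n - l) + l) by rewrite !El.
  have Eag : fac (i + (n - l)) l = fac (i' + (n - l)) l by apply/fac_agree.
  have rs : fac (i + (n - l)) l \in right_special l.
    by apply/right_specialP; exists (i + (n - l)), (i' + (n - l)).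
  by case: (aperiodic_extension ag ne'); [exists i | exists i' => _; split; rewrite -?Eag].
pose suf w := fac (o w + (n - l)) l.
rewrite -sum1_card (partition_big suf (mem (right_special l))) /=; last first.
  by move=> w /Ho[].
apply: (@leq_trans (\sum_(z in right_special l) (16 * C + 1))); last first.
  apply: leq_trans (leq_addr _ _).
  by rewrite sum_nat_const leq_mul2r fewl orbT.
apply: leq_sum => z _; rewrite sum1_card.
pose D := [set w in right_special n | suf w == z].
rewrite (eq_card (_ : _ =i D)); last by move=> w; rewrite [RHS]inE.
have DP w : w \in D -> w \in right_special n /\ suf w = z.
  by rewrite inE => /andP[? /eqP].
have : #|D|.-1 * l./2 <= rho x (2 * n).
  apply: (@special_fiber _ D o); first exact: ltnW.
  - move=> a b /DP[/Ho[Ea _ _] _] /DP[/Ho[Eb _ _] _] ag.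
    by rewrite Ea Eb; apply/fac_agree.
  - by move=> a b /DP[_ Ea] /DP[_ Eb]; apply/fac_agree/(etrans Ea (esym Eb)).
  - by move=> a /DP[/Ho[]].
move=> /leq_trans/(_ (rhoC (2 * n) _)) H.
(* Both bounds rest on [n >= 4] and [l >= n./2]; they turn [C * (2 * n)] into a multiple of [l./2]
   that can be cancelled. *)
have nh : n <= 8 * l./2 by lia.
have h0 : 0 < l./2 by lia.
have : #|D|.-1 * l./2 <= 16 * C * l./2.
  apply: leq_trans (H _) _; first by lia.
  by have := leq_mul (leqnn (2 * C)) nh; lia.
by rewrite leq_mul2r; lia.
Qed.

End Complexity.

(** * Coding dimension *)

Section CodingDimension.
Variables (A : finType) (x : nat -> A) (alpha : nat -> nat) (sigma : seq A -> {set A}).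
Hypothesis card_sigma : forall h, #|sigma h| = (alpha (size h)).+1.
Hypothesis win_sigma : forall a,
  (forall j, a j \in sigma (mkseq a j)) -> orbit_closure x a.

Fixpoint plays n : seq (seq A) :=
  if n is n'.+1 then [seq rcons h b | h <- plays n', b <- enum (sigma h)] else [:: [::]].

Let sigma_gt0 h : 0 < #|sigma h|. Proof. by rewrite card_sigma. Qed.

Lemma playsP n h : h \in plays n ->
  exists2 a, h = mkseq a n & forall j, a j \in sigma (mkseq a j).
Proof.
elim: n h => [|n IH] h /=.
  rewrite inE => /eqP->.
  by have [|a _ Ha] := @extend_play _ _ sigma_gt0 0 (fun=> x 0); [|exists a].
case/allpairsPdep=> h' [b [/IH[a Ea Ha]]]; rewrite mem_enum Ea => bB ->.
have [//|a' [a'a a'n Ha']] := @extend_play_at _ _ sigma_gt0 n a b _ bB.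
exists a' => //; rewrite mkseqS a'n; congr (rcons _ _).
by apply/eq_in_map => j; rewrite mem_iota => /andP[_ jn]; rewrite a'a.
Qed.

Lemma uniq_plays n : uniq (plays n).
Proof.
elim: n => //= n IH; apply: allpairs_uniq_dep => //.
  by move=> h _; apply: enum_uniq.
by move=> [h b] [h' b'] _ _ /= /rcons_inj[-> ->].
Qed.

(** Round [n] multiplies the positive number of plays by [alpha n + 1], so it adds at least
    [alpha n]. *)
Lemma sum_lt_plays n : \sum_(j < n) alpha j < size (plays n).
Proof.
elim: n => [|n IH]; first by rewrite big_ord0.
rewrite big_ord_recr /= size_allpairs_dep.
have /all_pred1P-> : all (pred1 (alpha n).+1) [seq size (enum (sigma h)) | h <- plays n].
  rewrite all_map; apply/allP=> h /playsP[a -> _] /=.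
  by rewrite -cardE card_sigma size_mkseq.
rewrite size_map sumn_nseq mulSn -addSn leq_add // leq_pmulr //.
exact: leq_ltn_trans IH.
Qed.

(** Bob has two possible answers in round [n], and both continuations of the play occur in [x]. *)
Lemma plays_right_special n : 0 < alpha n -> size (plays n) <= #|right_special x n|.
Proof.
move=> an; rewrite cardE -(size_map val); apply: uniq_leq_size; first exact: uniq_plays.
move=> h /playsP[a Eh Ha].
have cons_a : consistent sigma n a by move=> j _; apply: Ha.
have : 1 < #|sigma (mkseq a n)| by rewrite card_sigma size_mkseq ltnS.
case/card_gt1P=> b [b' [bB b'B bb']].
have occ c : c \in sigma (mkseq a n) ->
    exists2 i, forall j, j < n -> a j = x (i + j) & x (i + n) = c.
  move=> cB; have [a' [a'a a'n Ha']] := extend_play_at sigma_gt0 cons_a cB.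
  have [i Hi] := win_sigma Ha' n.+1; exists i; last by rewrite -Hi.
  by move=> j jn; rewrite -(Hi j (ltnW jn)) a'a.
have [i ai ib] := occ b bB; have [i' ai' ib'] := occ b' b'B.
apply/mapP; exists (fac x i n).
  rewrite mem_enum; apply/right_specialP; exists i, i'; split=> //.
    by apply/fac_agree => j jn; rewrite -ai // ai'.
  by rewrite ib ib'; apply/eqP.
rewrite val_fac Eh; apply/eq_in_map => j; rewrite mem_iota => /andP[_ jn].
exact: ai.
Qed.

End CodingDimension.

(** Bounded partial sums attain a maximum, and past that point every entry must vanish. *)
Lemma sum_leP (y : nat -> nat) d : (forall n, \sum_(i < n) y i <= d) -> sum_le y d.
Proof.
move=> bnd; pose P v := `[< exists n, \sum_(i < n) y i = v >].
have exP : exists v, P v by exists 0; apply/asboolP; exists 0; rewrite big_ord0.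
have leP v : P v -> v <= d by move=> /asboolP[n <-].
case: (ex_maxnP exP leP) => _ /asboolP[N <-] maxN.
exists N; split=> // i Ni; apply/eqP; rewrite -leqn0 -(leq_add2l (\sum_(j < N) y j)) addn0.
apply: leq_trans (maxN (\sum_(j < i.+1) y j) _); last by apply/asboolP; exists i.+1.
rewrite big_ord_recr /= leq_add2r -!(big_mkord xpredT y) [leqRHS](@big_cat_nat _ _ _ N) //=.
exact: leq_addr.
Qed.

Lemma finite_coding_dim_winning_shift (A : finType) (x : nat -> A) :
  (exists C N, forall n, N <= n -> rho x n <= C * n) ->
  finite_coding_dim (winning_shift (orbit_closure x)).
Proof.
move=> [C [N rhoC]].
have [K HK] : exists K, forall n, #|right_special x n| <= K.
  (* The second summand absorbs the finitely many lengths below [N]. *)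
  apply: (@right_special_bounded _ x (C + \max_(k < N) rho x k)) => n n0.
  case: (leqP N n) => [/rhoC|nN].
    by move=> /leq_trans; apply; rewrite leq_mul2r leq_addr orbT.
  apply: leq_trans (leq_pmulr _ n0); apply: leq_trans (leq_addl _ _).
  exact: (@leq_bigmax _ (fun k : 'I_N => rho x k) (Ordinal nN)).
(* At a nonzero entry [K] bounds the sum of all earlier entries and [#|A|] the entry itself. *)
exists (K + #|A|) => alpha [alphaA [sigma [card_s win_s]]]; apply: sum_leP.
elim=> [|n IH]; first by rewrite big_ord0.
rewrite big_ord_recr /=; case: (posnP (alpha n)) => [->|an]; first by rewrite addn0.
apply: leq_add (ltnW (alphaA n)); apply: leq_trans (HK n).
apply: leq_trans (plays_right_special card_s win_s an).
exact/ltnW/sum_lt_plays.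
Qed.

Lemma sum_count_mem_le n (t : seq nat) : \sum_(j < n) count_mem (nat_of_ord j) t <= size t.
Proof.
elim: t => [|a t IH]; first by rewrite big1.
rewrite /= big_split /= -add1n leq_add //.
suff -> : \sum_(j < n) (a == j) = (a < n) by case: (a < n).
elim: n {IH} => [|n IH]; first by rewrite big_ord0.
by rewrite big_ord_recr /= IH; lia.
Qed.

Lemma sum_le_count_mem (t : seq nat) d : size t <= d -> sum_le (fun j => count_mem j t) d.
Proof.
by move=> td; apply: sum_leP => n; apply: leq_trans (sum_count_mem_le n t) td.
Qed.

Theorem mainTheorem1 (Sigma : finType) (rep : nat -> seq Sigma)
    (rep_inj : injective rep) (Hadd : addable rep)
    (A : finType) (x : nat -> A) (Hauto : automatic rep x)
    (Hlin : exists C N, forall n, N <= n -> rho x n <= C * n) :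
  codable rep (winning_shift (orbit_closure x)).
Proof.
split; last exact: finite_coding_dim_winning_shift.
(* Counting recovers [y] from its code [t], and its sum is at most [i <= k]. *)
move=> k i /andP[_ ik]; have := rec_winning_shift rep_inj Hadd Hauto i.
congr (recognizable rep _); apply/funext=> t; apply/propext.
split=> [[sorted_t Ht]|[y [Hy [_ [sorted_t Ey]]]]].
  exists (fun j => count_mem j t); split=> //; split=> //.
  by apply: sum_le_count_mem; rewrite size_tuple.
split=> //; suff <- : y = (fun j => count_mem j t) by [].
by apply/funext=> j; rewrite Ey.
Qed.
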